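(* Let $G$ and $H$ be non-trivial connected graphs where $H$ is not complete. Then $th(G\circ H)=2$.
   Context: All graphs are finite, undirected, without loops or multiple edges; a graph is non-trivial if it has at least two vertices. The lexicographic product $G\circ H$ has vertex set $V(G)\times V(H)$, and $(g_1,h_1)$, $(g_2,h_2)$ are adjacent if either $g_1g_2\in E(G)$ or ($g_1=g_2$ and $h_1h_2\in E(H)$). For distinct non-adjacent vertices $u,v$ of a graph $F$, a tolled walk between $u$ and $v$ is a sequence of vertices $u,w_1,\ldots,w_k,v$ with $k\ge 1$ such that $w_iw_{i+1}\in E(F)$ for all $1\le i<k$, $uw_i\in E(F)$ if and only if $i=1$, and $vw_i\in E(F)$ if and only if $i=k$. If $uv\in E(F)$, the only tolled walk between $u$ and $v$ is $u,v$; the only tolled walk from $v$ to $v$ is $v$ itself. The toll interval $T_F(u,v)$ is the set of all vertices lying on some tolled walk between $u$ and $v$. A set $S\subseteq V(F)$ is t-convex if $T_F(u,v)\subseteq S$ for all $u,v\in S$. The t-convex hull $[S]_t$ of $S\subseteq V(F)$ is the intersection of all t-convex sets containing $S$; $S$ is a t-hull set of $F$ if $[S]_t=V(F)$. The t-hull number $th(F)$ is the minimum size of a t-hull set of $F$. *)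

(* Defs.v *)
From mathcomp Require Import all_boot.
From mathcomp Require Import boolp.

Set Implicit Arguments.
Unset Strict Implicit.
Unset Printing Implicit Defensive.

Record sgraph := SGraph {
  vertex :> finType;
  edge : rel vertex;
  edge_sym : symmetric edge;
  edge_irrefl : irreflexive edge
}.

Notation "x -- y" := (edge x y) (at level 30).

Definition nontrivial (G : sgraph) : bool := 2 <= #|G|.

Definition connected (G : sgraph) : Prop :=
  forall x y : G, connect (@edge G) x y.

Definition complete (G : sgraph) : Prop :=
  forall x y : G, x != y -> x -- y.

Section LexicographicProduct.
Variables G H : sgraph.

Definition lex_edge : rel (G * H)%type :=
  [rel p q | (p.1 -- q.1) || (p.1 == q.1) && (p.2 -- q.2)].

Lemma lex_edge_sym : symmetric lex_edge.
Proof. by move=> p q; rewrite /lex_edge /= edge_sym eq_sym (edge_sym p.2). Qed.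

Lemma lex_edge_irrefl : irreflexive lex_edge.
Proof. by move=> p; rewrite /lex_edge /= !edge_irrefl andbF. Qed.

Definition lexprod : sgraph := SGraph lex_edge_sym lex_edge_irrefl.

End LexicographicProduct.

Section TollConvexity.
Variable F : sgraph.
Implicit Types (u v x : F) (s w : seq F) (S C : {set F}).

(* [w] lists the inner vertices w_1, ..., w_k, so w_i is [nth u w i.-1]; the
   default value of [nth] is never reached. *)
Definition tolled_inner u v w : Prop :=
  [/\ 0 < size w,
      sorted (@edge F) w,
      forall i, i < size w -> (u -- nth u w i) = (i == 0)
    & forall i, i < size w -> (v -- nth u w i) = (i == (size w).-1)].

Definition tolled_walk u v s : Prop :=
  if u == v then s = [:: v]
  else if u -- v then s = [:: u; v]
  else exists2 w, tolled_inner u v w & s = u :: rcons w v.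

Definition toll_interval u v : {set F} :=
  [set x | `[< exists2 s, tolled_walk u v s & x \in s >]].

Definition tconvex S : bool :=
  [forall u in S, forall v in S, toll_interval u v \subset S].

Definition thull S : {set F} :=
  \bigcap_(C : {set F} | tconvex C && (S \subset C)) C.

Definition thull_set S : bool := thull S == [set: F].

(* The default [set: F] satisfies the condition (see [thull_setT]), so this is
   a genuine minimum. *)
Definition thull_number : nat :=
  #|[arg min_(S < [set: F] | thull_set S) #|S|]|.

Lemma thull_setT : thull_set [set: F].
Proof.
rewrite /thull_set eqEsubset subsetT /=.
by apply/bigcapsP => C /andP[].
Qed.

End TollConvexity.

(* Main.v *)
Require Import Defs.
From mathcomp Require Import all_boot.
From mathcomp Require Import boolp.

(** Two distinct non-adjacent vertices have all their common neighbours in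
    their toll interval, since a walk with a single inner vertex is tolled
    exactly when that vertex is adjacent to both ends.  In a lexicographic
    product, if [g] and [g'] are adjacent in [G], every vertex of the layer
    [{g'} x H] is a common neighbour of any two vertices of the layer [{g} x H].
    As [H] is not complete, each layer contains a non-adjacent pair; hence a
    t-convex set that contains such a pair in one layer contains the adjacent
    layers entirely ([tconvex_lex_step]), and by connectivity of [G] it
    contains everything ([thull_set_lex_pair]).  So a non-adjacent pair in a
    single layer is a t-hull set of size two.

    No smaller set works, because the empty set and the singletons are t-convex
    ([thull_number_ge2]). *)

Set Implicit Arguments.
Unset Strict Implicit.
Unset Printing Implicit Defensive.

Section Toll.
Variable F : sgraph.
Implicit Types (u v x : F) (S C : {set F}).

Lemma common_neighbour_toll_interval u v x :
  u != v -> ~~ (u -- v) -> u -- x -> v -- x -> x \in toll_interval u v.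
Proof.
move=> neq_uv nadj_uv ux vx; rewrite inE; apply/asboolP.
exists [:: u; x; v]; last by rewrite !inE eqxx orbT.
rewrite /tolled_walk (negPf neq_uv) (negPf nadj_uv).
by exists [:: x] => //; split=> // -[].
Qed.

Lemma tconvexP S :
  reflect (forall u v, u \in S -> v \in S -> toll_interval u v \subset S)
          (tconvex S).
Proof.
apply: (iffP forall_inP) => [cS u v uS vS | cS u uS].
  exact: (forall_inP (cS u uS)).
by apply/forall_inP => v vS; apply: cS.
Qed.

Lemma tconvex_card_le1 S : #|S| <= 1 -> tconvex S.
Proof.
move=> /card_le1_eqP S_eq; apply/tconvexP => u v uS vS.
rewrite -(S_eq u v uS vS); apply/subsetP => x; rewrite inE.
by case/asboolP => s; rewrite /tolled_walk eqxx => ->; rewrite inE => /eqP ->.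
Qed.

Lemma thull_setP S :
  reflect (forall C, tconvex C -> S \subset C -> C = [set: F]) (thull_set S).
Proof.
apply: (iffP eqP) => [hullS C cC sSC | hullS].
  apply/eqP; rewrite eqEsubset subsetT -hullS.
  by apply: bigcap_inf; rewrite cC.
by apply: big1 => C /andP[cC sSC]; apply: hullS.
Qed.

Lemma thull_number_le S : thull_set S -> thull_number F <= #|S|.
Proof.
rewrite /thull_number; case: arg_minnP => [|T _ Tmin]; first exact: thull_setT.
exact: Tmin.
Qed.

Lemma thull_number_ge2 : nontrivial F -> 2 <= thull_number F.
Proof.
rewrite /nontrivial /thull_number => F2.
case: arg_minnP => [|T /thull_setP hullT _]; first exact: thull_setT.
rewrite ltnNge; apply/negP => T1.
by move: F2; rewrite -cardsT -(hullT T) ?tconvex_card_le1 // ltnNge T1.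
Qed.

End Toll.

Lemma connected_has_edge (G : sgraph) :
  nontrivial G -> connected G -> exists g g' : G, g -- g'.
Proof.
move=> /card_gt1P[x [y [_ _ neq_xy]]] /(_ x y) /connectP[[|z p] /=].
  by move=> _ eq_yx; rewrite eq_yx eqxx in neq_xy.
by case/andP => xz _ _; exists x, z.
Qed.

Section Lexicographic.
Variables (G H : sgraph) (h1 h2 : H).
Hypotheses (neq_h : h1 != h2) (nadj_h : ~~ (h1 -- h2)).
Implicit Types (g : G) (C : {set lexprod G H}).

(** The vertices of the layer over a neighbour of [g] are common neighbours of
    the non-adjacent pair [(g, h1)], [(g, h2)]. *)
Lemma tconvex_lex_step C g g' :
  tconvex C -> g -- g' -> (g, h1) \in C -> (g, h2) \in C ->
  forall h, (g', h) \in C.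
Proof.
move=> /tconvexP cC gg' C1 C2 h.
apply: (subsetP (cC _ _ C1 C2)).
apply: common_neighbour_toll_interval.
- by rewrite xpair_eqE eqxx.
- by rewrite /= /lex_edge /= edge_irrefl eqxx.
- by rewrite /= /lex_edge /= gg'.
- by rewrite /= /lex_edge /= gg'.
Qed.

(** The layers contained in a t-convex set are closed under adjacency in [G].
    The initial pair only fills the layers next to its own, so the propagation
    starts from the layer over a neighbour [g'] of [g] and then comes back. *)
Lemma thull_set_lex_pair g g' :
  connected G -> g -- g' ->
  thull_set [set ((g, h1) : lexprod G H); ((g, h2) : lexprod G H)].
Proof.
move=> connG gg'; apply/thull_setP => C cC.
rewrite subUset !sub1set => /andP[C1 C2].
pose full := [pred x : G | [forall h, (x, h) \in C]].
have full_g' : g' \in full.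
  by apply/forallP; apply: tconvex_lex_step gg' C1 C2.
have full_step x y : x -- y -> x \in full -> y \in full.
  move=> xy /forallP Cx; apply/forallP.
  exact: tconvex_lex_step cC xy (Cx h1) (Cx h2).
have full_closed : closed (@edge G) full.
  move=> x y xy; apply/idP/idP; first exact: full_step.
  by apply: full_step; rewrite edge_sym.
apply/setP => -[x h]; rewrite in_setT.
have : x \in full by rewrite -(closed_connect full_closed (connG g' x)).
by move/forallP/(_ h).
Qed.

End Lexicographic.

Lemma nontrivial_lexprod (G H : sgraph) :
  nontrivial G -> nontrivial H -> nontrivial (lexprod G H).
Proof.
rewrite /nontrivial /= card_prod => G2 H2.
exact: leq_trans (leq_mul G2 H2).
Qed.

Lemma not_complete_pair (H : sgraph) :
  ~ complete H -> exists h1 h2 : H, h1 != h2 /\ ~~ (h1 -- h2).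
Proof.
move=> ncH; apply: contrapT => no_pair; apply: ncH => x y neq_xy.
by apply: contrapT => /negP nadj_xy; apply: no_pair; exists x, y.
Qed.

Theorem corollary4p2 (G H : sgraph) :
  nontrivial G -> nontrivial H ->
  connected G -> connected H -> ~ complete H ->
  thull_number (lexprod G H) = 2.
Proof.
move=> G2 H2 connG _ /not_complete_pair[h1 [h2 [neq_h nadj_h]]].
have [g [g' gg']] := connected_has_edge G2 connG.
apply/eqP; rewrite eqn_leq thull_number_ge2 ?nontrivial_lexprod // andbT.
apply: leq_trans (thull_number_le (thull_set_lex_pair neq_h nadj_h connG gg')) _.
by rewrite cards2; case: (_ != _).
Qed.
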